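(* Let $a_0,a_1,a_2,b_0,b_1,b_2,q$ be indeterminates and put $\mathbf{x}=(a_0,a_1,a_2,b_0,b_1,b_2,q)$. Let $[T_{n,k}]_{n,k\ge0}$ be a triangular array with $T_{0,0}=1$ and $T_{n,k}=0$ unless $0\le k\le n$, which satisfies, for all $n\ge1$ and all $k$, any one of the following recurrences: (i) $T_{n,k}=[a_0(n-1)+a_2]T_{n-1,k}+[b_0(n-1)+b_2]T_{n-1,k-1}$; (ii) $T_{n,k}=[a_0(b_0+b_1)(n-1)+a_0b_1k+a_0b_2]T_{n-1,k}+[b_0(n-1)+b_1(k-1)+b_2]T_{n-1,k-1}$; (iii) $T_{n,k}=(a_1k+a_2)T_{n-1,k}+[b_1(k-1)+b_2]T_{n-1,k-1}$; (iv) $T_{n,k}=[a_0(n-k-1)+a_2]T_{n-1,k}+[b_0(n-k)+b_2]T_{n-1,k-1}$; (v) $T_{n,k}=(a_1k+a_2)T_{n-1,k}+(b_0n-b_0k+b_2)T_{n-1,k-1}$, where $0\in\{a_2,\,b_2,\,a_1-a_2,\,b_0-b_2\}$; (vi) $T_{n,k}=b_0\left(n-2k+\frac{2a_2-a_1}{a_1}\right)T_{n-1,k}+[a_1(n-k)+a_2]T_{n-1,k-1}$; (vii) $T_{n,k}=(a_1k+a_2)T_{n-1,k}+b_0\left(2k-n+\frac{2a_2-a_1}{a_1}\right)T_{n-1,k-1}$. Let $T_n(q)=\sum_{k\ge0}T_{n,k}q^k$. Then $(T_n(q))_{n\ge0}$ is an $\mathbf{x}$-Stieltjes moment sequence and a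 $3$-$\mathbf{x}$-log-convex sequence.
   Context: For a set of indeterminates $\mathbf{x}$, write $f\ge_{\mathbf{x}}0$ if $f$ is a polynomial in $\mathbf{x}$ with nonnegative coefficients. A matrix is $\mathbf{x}$-totally positive ($\mathbf{x}$-TP) if all its minors are $\ge_{\mathbf{x}}0$, and $\mathbf{x}$-TP$_r$ if all its minors of order $\le r$ are $\ge_{\mathbf{x}}0$. A sequence $(\alpha_n)_{n\ge0}$ is an $\mathbf{x}$-Stieltjes moment ($\mathbf{x}$-SM) sequence if its Hankel matrix $[\alpha_{i+j}]_{i,j\ge0}$ is $\mathbf{x}$-TP. Define $\mathcal{L}[\alpha_i]=\alpha_{i-1}\alpha_{i+1}-\alpha_i^2$ for $i\ge1$ and $\mathcal{L}^m=\mathcal{L}(\mathcal{L}^{m-1})$; the sequence is $k$-$\mathbf{x}$-log-convex if $\mathcal{L}^m[\alpha_i]\ge_{\mathbf{x}}0$ for all $m\le k$ and all $i$ for which it is defined.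
   Formalization: In (vi) and (vii) T_1(q) contains 2a_2b_0/a_1, not a polynomial in x, so there nonnegativity is taken in x together with b_0/a_1; the condition in (v) is read as specializing a_2 to 0 or a_1, or b_2 to 0 or b_0. *)

(* Defs.v *)
From HB Require Import structures.
From mathcomp Require Import all_boot all_order all_algebra.
From mathcomp Require Export mpoly.

Set Implicit Arguments.
Unset Strict Implicit.
Unset Printing Implicit Defensive.

Import Order.TTheory GRing.Theory Num.Theory.
Local Open Scope ring_scope.

(* Rational functions in seven indeterminates, needed because two of the
   recurrences contain the quotient (2 a2 - a1) / a1. *)
Definition ratfun (R : realDomainType) := {fraction {mpoly R[7]}}.

Definition indet (R : realDomainType) (i : 'I_7) : ratfun R :=
  tofrac ('X_i : {mpoly R[7]}).

(* f is a polynomial expression with nonnegative coefficients in the entries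
   of y. When y lists the seven indeterminates this says that the rational
   function f is a polynomial all of whose coefficients are nonnegative. *)
Definition coef_ge0 (R : realDomainType) (m : nat) (y : m.-tuple (ratfun R))
    (f : ratfun R) : Prop :=
  exists p : {mpoly R[m]},
    (forall e : 'X_{1..m}, 0 <= p@_e) /\
    f = mmap (fun c : R => tofrac (c%:MP : {mpoly R[7]})) (tnth y) p.

Definition increasing (k : nat) (r : 'I_k -> nat) : Prop :=
  forall i j : 'I_k, (i < j)%N -> (r i < r j)%N.

Definition totally_positive (R : realDomainType) (m : nat)
    (y : m.-tuple (ratfun R)) (M : nat -> nat -> ratfun R) : Prop :=
  forall (k : nat) (r c : 'I_k -> nat), increasing r -> increasing c ->
    coef_ge0 y (\det (\matrix_(i < k, j < k) M (r i) (c j))).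

Definition stieltjes_moment (R : realDomainType) (m : nat)
    (y : m.-tuple (ratfun R)) (alpha : nat -> ratfun R) : Prop :=
  totally_positive y (fun i j => alpha (i + j)%N).

(* The operator is meant for i >= 1 only; the value at i = 0 is junk. *)
Definition logop (K : nzRingType) (alpha : nat -> K) (i : nat) : K :=
  alpha i.-1 * alpha i.+1 - alpha i ^+ 2.

(* The m-th iterate of the operator is defined exactly at the indices
   i >= m, and none of those values involves the junk values of logop. *)
Definition log_convex (R : realDomainType) (k m : nat)
    (y : m.-tuple (ratfun R)) (alpha : nat -> ratfun R) : Prop :=
  forall l i : nat, (l <= k)%N -> (l <= i)%N ->
    coef_ge0 y (iter l (@logop (ratfun R)) alpha i).

(* Arrays have an integer column index, so that T (n - 1) (k - 1) makes sense
   at k = 0. *)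
Definition triangular (K : nzRingType) (T : nat -> int -> K) : Prop :=
  T 0%N 0 = 1 /\
  forall (n : nat) (k : int), ~~ (0 <= k <= n%:Z) -> T n k = 0.

Definition recurrence (K : nzRingType) (f g : K -> K -> K)
    (T : nat -> int -> K) : Prop :=
  forall (n : nat) (k : int), (1 <= n)%N ->
    T n k = f n%:R k%:~R * T n.-1 k + g n%:R k%:~R * T n.-1 (k - 1).

Definition rec_i (K : nzRingType) (a0 a2 b0 b2 : K) :=
  recurrence (fun n k => a0 * (n - 1) + a2)
             (fun n k => b0 * (n - 1) + b2).

Definition rec_ii (K : nzRingType) (a0 b0 b1 b2 : K) :=
  recurrence
    (fun n k => a0 * (b0 + b1) * (n - 1) + a0 * b1 * k + a0 * b2)
    (fun n k => b0 * (n - 1) + b1 * (k - 1) + b2).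

Definition rec_iii (K : nzRingType) (a1 a2 b1 b2 : K) :=
  recurrence (fun n k => a1 * k + a2)
             (fun n k => b1 * (k - 1) + b2).

Definition rec_iv (K : nzRingType) (a0 a2 b0 b2 : K) :=
  recurrence (fun n k => a0 * (n - k - 1) + a2)
             (fun n k => b0 * (n - k) + b2).

Definition rec_v (K : nzRingType) (a1 a2 b0 b2 : K) :=
  recurrence (fun n k => a1 * k + a2)
             (fun n k => b0 * n - b0 * k + b2).

Definition rec_vi (K : fieldType) (a1 a2 b0 : K) :=
  recurrence (fun n k => b0 * (n - 2 * k + (2 * a2 - a1) / a1))
             (fun n k => a1 * (n - k) + a2).

Definition rec_vii (K : fieldType) (a1 a2 b0 : K) :=
  recurrence (fun n k => a1 * k + a2)
             (fun n k => b0 * (2 * k - n + (2 * a2 - a1) / a1)).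

(* The condition 0 \in {a2, b2, a1 - a2, b0 - b2} is a specialization of the
   indeterminates: a2 becomes 0 or a1, or b2 becomes 0 or b0 (or both). *)
Definition rec_v_special (K : fieldType) (a1 a2 b0 b2 : K)
    (T : nat -> int -> K) : Prop :=
  exists a2' b2' : K,
    [/\ a2' \in [:: a2; 0; a1], b2' \in [:: b2; 0; b0],
        0 \in [:: a2'; b2'; a1 - a2'; b0 - b2'] &
        rec_v a1 a2' b0 b2' T].

Definition row_poly (K : nzRingType) (q : K) (T : nat -> int -> K) (n : nat) : K :=
  \sum_(k < n.+1) T n k%:Z * q ^+ k.

(* Main.v *)
(* If u, v, w are sequences of elements with nonnegative coefficients, the
   tridiagonal matrix J with superdiagonal 1, diagonal u_k + v_k + w_k and
   subdiagonal u_(k-1) v_k factors, up to inserting intermediate rows, into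
   matrices whose consecutive rows overlap in at most one place, and such factors
   preserve total positivity. Hence the matrix A of the path sums (J^n)_(0,k) is
   totally positive, and so is the Hankel matrix of (J^n)_(0,0), which is
   A D A^T with D diagonal and nonnegative.

   In each case the homogenized row polynomials, restricted to a suitable curve,
   satisfy p_(n+1) = (c0 + c1 X) p_n + (d0 + d1 X + d2 X^2) p_n', so that their
   Taylor coefficients form a table with tridiagonal production matrix. For
   (i)-(v) the curve is a line, except that in (ii) the rows are simply rising
   factorials. For (vi) and (vii) the vector field of the recurrence preserves
   p^2 + 2 p Q, and the curve is a level set of this invariant. *)
Require Import Defs.
From HB Require Import structures.
From mathcomp Require Import all_boot all_order all_algebra.
From mathcomp Require Import zify ring.

Set Implicit Arguments.
Unset Strict Implicit.
Unset Printing Implicit Defensive.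

Import Order.TTheory GRing.Theory Num.Theory.
Local Open Scope ring_scope.

(** * Total positivity over a semiring of nonnegative elements *)

Section Cone.

Variables (K : comNzRingType) (P : K -> Prop).

(** Nonnegativity enters only through these closure properties; the instance used in the end is
    [coef_ge0 y]. *)
Record semiring_pred : Prop := SemiringPred {
  cone0 : P 0;
  cone1 : P 1;
  coneD : forall x y, P x -> P y -> P (x + y);
  coneM : forall x y, P x -> P y -> P (x * y)
}.

Hypothesis Psr : semiring_pred.

Lemma cone_sum (I : Type) (r : seq I) (p : pred I) (F : I -> K) :
  (forall i, p i -> P (F i)) -> P (\sum_(i <- r | p i) F i).
Proof. by move=> PF; elim/big_rec: _ => [|i x /PF]; [case: Psr | apply: coneD]. Qed.

Lemma cone_prod (I : Type) (r : seq I) (p : pred I) (F : I -> K) :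
  (forall i, p i -> P (F i)) -> P (\prod_(i <- r | p i) F i).
Proof. by move=> PF; elim/big_rec: _ => [|i x /PF]; [case: Psr | apply: coneM]. Qed.

Lemma cone_nat n : P n%:R.
Proof.
elim: n => [|n IHn]; first by case: Psr.
by rewrite -natr1; apply: coneD => //; case: Psr.
Qed.

Definition tp (M : nat -> nat -> K) : Prop :=
  forall (k : nat) (r c : 'I_k -> nat), increasing r -> increasing c ->
    P (\det (\matrix_(i < k, j < k) M (r i) (c j))).

Lemma tp_ext M N : (forall i j, M i j = N i j) -> tp M -> tp N.
Proof.
move=> eqMN tpM k r c r_inc c_inc.
suff -> : \matrix_(i, j) N (r i) (c j) = \matrix_(i, j) M (r i) (c j) by apply: tpM.
by apply/matrixP => i j; rewrite !mxE eqMN.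
Qed.

Lemma tp_tr M : tp M -> tp (fun i j => M j i).
Proof.
move=> tpM k r c r_inc c_inc; rewrite -det_tr.
suff -> : (\matrix_(i, j) M (c j) (r i))^T = \matrix_(i, j) M (c i) (r j) by apply: tpM.
by apply/matrixP => i j; rewrite !mxE.
Qed.

Lemma det_row_sum k (i0 : 'I_k) (I : Type) (s : seq I) (c : I -> K)
    (v : I -> 'I_k -> K) (A : 'I_k -> 'I_k -> K) :
  \det (\matrix_(i, j) if i == i0 then \sum_(l <- s) c l * v l j else A i j) =
  \sum_(l <- s) c l * \det (\matrix_(i, j) if i == i0 then v l j else A i j).
Proof.
elim: s => [|l s IHs].
  rewrite big_nil (expand_det_row _ i0) big1 // => j _.
  by rewrite mxE eqxx big_nil mul0r.
rewrite big_cons -IHs -[X in _ = _ + X]mul1r.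
apply: (@determinant_multilinear _ _ _ _ _ i0).
- by apply/rowP => j; rewrite !mxE eqxx big_cons mul1r.
- by apply/matrixP => i j; rewrite !mxE eq_sym (negbTE (neq_lift _ _)).
- by apply/matrixP => i j; rewrite !mxE eq_sym (negbTE (neq_lift _ _)).
Qed.

Definition row_comb (M : nat -> nat -> K) (a b : nat) (v : nat -> K) : Prop :=
  exists2 c : nat -> K, (forall l, P (c l)) &
    forall j, v j = \sum_(a <= l < b.+1) c l * M l j.

Lemma row_comb_ext M a b v v' :
  (forall j, v j = v' j) -> row_comb M a b v' -> row_comb M a b v.
Proof. by move=> vv' [c cP v'E]; exists c => // j; rewrite vv'. Qed.

Lemma row_comb_row M a b l : (a <= l <= b)%N -> row_comb M a b (M l).
Proof.
move=> alb; exists (fun i => (i == l)%:R) => [i|j]; first exact: cone_nat.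
rewrite (bigD1_seq l) ?mem_index_iota ?iota_uniq ?ltnS //=.
rewrite eqxx mul1r big1 ?addr0 // => i /negbTE->.
by rewrite mul0r.
Qed.

Lemma row_combD M a b v v' :
  row_comb M a b v -> row_comb M a b v' -> row_comb M a b (fun j => v j + v' j).
Proof.
move=> [c cP vE] [c' c'P v'E]; exists (fun l => c l + c' l) => [l|j].
  exact: coneD.
by rewrite vE v'E -big_split; apply: eq_bigr => l _; rewrite mulrDl.
Qed.

Lemma row_combZ M a b x v :
  P x -> row_comb M a b v -> row_comb M a b (fun j => x * v j).
Proof.
move=> xP [c cP vE]; exists (fun l => x * c l) => [l|j]; first exact: coneM.
by rewrite vE mulr_sumr; apply: eq_bigr => l _; rewrite mulrA.
Qed.

(* Consecutive rows of [N] combine overlapping blocks of rows of [M] that share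
   at most one row. Expanding a minor of [N] row by row therefore only produces
   minors of [M] with increasing rows and determinants with a repeated row. *)
Lemma tp_block (lo : nat -> nat) (M N : nat -> nat -> K) :
    (forall i, (lo i <= lo i.+1)%N) ->
    (forall i, row_comb M (lo i) (lo i.+1) (N i)) ->
  tp M -> tp N.
Proof.
move=> lo_le NE tpM k r col r_inc col_inc.
have lo_mono : {homo lo : i j / (i <= j)%N}.
  by apply: homo_leq => //; apply: leq_trans.
(* Rows before [j] have already been replaced by rows [f i] of [M], in increasing order and each
   within its block; [d] rows of [N] remain to be expanded. *)
have gen : forall d j, (d + j)%N = k -> forall f : nat -> nat,
    (forall i i' : 'I_k, (i < i' < j)%N -> (f i < f i')%N) ->
    (forall i : 'I_k, (i < j)%N -> (f i <= lo (r i).+1)%N) ->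
    P (\det (\matrix_(i < k, h < k)
         (if (i < j)%N then M (f i) (col h) else N (r i) (col h)))); last first.
  have := gen k 0%N (addn0 k) id; set A := (X in \det X).
  set B := (X in \det X) => gen0.
  suff <- : A = B by apply: gen0 => [i i'|i]; rewrite ltn0 ?andbF.
  by apply/matrixP => i h; rewrite !mxE.
elim=> [|d IHd] j djk f f_inc f_le.
  rewrite add0n in djk; subst j.
  suff -> : \matrix_(i < k, h < k)
     (if (i < k)%N then M (f i) (col h) else N (r i) (col h)) =
     \matrix_(i < k, h < k) M (f i) (col h).
    apply: (tpM k (fun i => f i)) => // i i' ii'.
    by apply: f_inc; rewrite ii' ltn_ord.
  by apply/matrixP => i h; rewrite !mxE ltn_ord.
have lt_jk : (j < k)%N by rewrite -djk; lia.
pose j0 := Ordinal lt_jk.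
have [c cP NjE] := NE (r j0).
set B := (X in \det X).
have -> : B = \matrix_(i, h) if i == j0
    then \sum_(lo (r j0) <= l < (lo (r j0).+1).+1) c l * M l (col h)
    else if (i < j)%N then M (f i) (col h) else N (r i) (col h).
  apply/matrixP => i h; rewrite !mxE; case: eqP => [->|//].
  by rewrite ltnn NjE.
rewrite (det_row_sum _ _ _ (fun l h => M l (col h))
  (fun i h => if (i < j)%N then M (f i) (col h) else N (r i) (col h))).
rewrite big_seq; apply: cone_sum => l; rewrite mem_index_iota ltnS => /andP[lo_l l_lo].
apply: coneM => //.
case: (boolP [exists i : 'I_k, (i < j)%N && (f i == l)]) =>
  [/existsP[i /andP[lt_ij /eqP fi]]|/existsPn nf].
  rewrite (@determinant_alternate _ _ _ i j0) //; first by case: Psr.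
    by apply/eqP => /(congr1 val) /=; lia.
  move=> h; rewrite !mxE eqxx ifN ?lt_ij ?fi //.
  by apply/eqP => /(congr1 val) /=; lia.
pose f' i := if i == j then l else f i.
have -> : \matrix_(i, h) (if i == j0 then M l (col h)
     else if (i < j)%N then M (f i) (col h) else N (r i) (col h)) =
   \matrix_(i < k, h < k)
     (if (i < j.+1)%N then M (f' i) (col h) else N (r i) (col h)).
  apply/matrixP => i h; rewrite !mxE -val_eqE /= /f' ltnS.
  by case: (ltngtP i j).
apply: IHd; first by lia.
- move=> i i' /andP[ii' i'j]; rewrite /f'.
  case: (eqVneq (i' : nat) j) => [ei'|ni'].
    rewrite ifN; last by lia.
    have lt_ij : (i < j)%N by lia.
    have := nf i; rewrite lt_ij /= => nfi.
    (* The block of an earlier row ends no later than the block of row [j] begins, so equality with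
       [l], excluded by [nf], is the only obstacle to strict increase. *)
    have : (f i <= l)%N.
      apply: leq_trans (f_le _ lt_ij) _; apply: leq_trans lo_l.
      by apply: lo_mono; apply: r_inc.
    by rewrite leq_eqVlt (negbTE nfi).
  by rewrite ifN; [apply: f_inc; lia | lia].
- move=> i ij; rewrite /f'; case: (eqVneq (i : nat) j) => [ei|ni].
    by have -> : i = j0 by apply: val_inj.
  by apply: f_le; lia.
Qed.

Lemma tp_diag_mul (d : nat -> K) (M : nat -> nat -> K) :
  (forall i, P (d i)) -> tp M -> tp (fun i j => d i * M i j).
Proof.
move=> dP; apply: (@tp_block id) => // i.
by apply: row_combZ => //; apply: row_comb_row; rewrite leqnn leqnSn.
Qed.

(** Let [i0] be the first position where the two index sequences differ. If [r i0] is the smaller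
    entry, row [i0] of the minor is zero; otherwise column [i0] is. *)
Lemma tp_id : tp (fun i j => (i == j)%:R).
Proof.
move=> k r c r_inc c_inc.
case: (boolP [forall i, r i == c i]) => [/'forall_eqP rc|].
  rewrite (_ : \matrix_(i, j) _ = 1%:M) ?det1; first by case: Psr.
  apply/matrixP => i j; rewrite !mxE rc; congr (_%:R).
  congr nat_of_bool; apply/eqP/eqP => [|-> //].
  case: (ltngtP i j) => [/c_inc|/c_inc|/val_inj //] + e; by rewrite e ltnn.
rewrite negb_forall => /existsP[i1 ri1].
have [i0 ri0 i0_min] := @arg_minnP _ i1 (fun i => r i != c i) (fun i => val i) ri1.
have rc (j : 'I_k) : (j < i0)%N -> r j = c j.
  by move=> ji; apply/eqP; apply: contraLR ji => /i0_min; rewrite -leqNgt.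
have mono (s : 'I_k -> nat) (i j : 'I_k) : increasing s -> (i <= j)%N -> (s i <= s j)%N.
  by move=> s_inc; rewrite leq_eqVlt => /orP[/eqP/val_inj-> //|/s_inc/ltnW].
case: (ltngtP (r i0) (c i0)) => [lt|gt|e]; last by rewrite e eqxx in ri0.
- rewrite (expand_det_row _ i0) big1 => [|j _]; first by case: Psr.
  rewrite mxE (_ : (_ == _) = false) ?mul0r //; apply/eqP => e.
  case: (ltnP j i0) => [ji|/(mono c _ _ c_inc)]; last by lia.
  by have := r_inc _ _ ji; rewrite rc //; lia.
- rewrite (expand_det_col _ i0) big1 => [|j _]; first by case: Psr.
  rewrite mxE (_ : (_ == _) = false) ?mul0r //; apply/eqP => e.
  case: (ltnP j i0) => [ji|/(mono r _ _ r_inc)]; last by lia.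
  by have := c_inc _ _ ji; rewrite -rc //; lia.
Qed.

End Cone.

Ltac cone Psr := repeat first
  [ assumption | exact: (cone0 Psr) | exact: (cone_nat Psr)
  | apply: (coneD Psr) | apply: (coneM Psr) ].

(** * Tridiagonal production matrices *)

Section TridiagonalMatrices.

Variables (K : comNzRingType) (P : K -> Prop).
Hypothesis Psr : semiring_pred P.
Local Notation tp := (tp P).

(* The subdiagonal entry at level [k] times the superdiagonal one below it;
   the value at [k = 0] is the absent weight of a step below level [0]. *)
Definition down_weight (u v : nat -> K) (k : nat) : K :=
  if k is k'.+1 then u k' * v k else 0.

(* The rows [M (m + k) + u (k - 1) M (m + k - 1)] interleaved with the rows
   [M (m + k)] form an intermediate matrix, and each new row combines three
   consecutive rows of it. *)
Lemma tp_tridiagonal (m : nat) (u v w : nat -> K) (M N : nat -> nat -> K) :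
    (forall k, P (u k)) -> (forall k, P (v k)) -> (forall k, P (w k)) ->
    (forall i j, (i <= m)%N -> N i j = M i j) ->
    (forall k j, N (m + k).+1 j = M (m + k).+1 j +
       (u k + v k + w k) * M (m + k)%N j +
       down_weight u v k * M (m + k).-1 j) ->
  tp M -> tp N.
Proof.
move=> uP vP wP Nle Ngt tpM.
pose Z i j := if (i <= m)%N then M i j else
  let k := (i - m)./2 in
  if odd (i - m) then M (m + k)%N j
  else M (m + k)%N j + u k.-1 * M (m + k).-1 j.
have Zodd k j : Z (m + k.*2.+1)%N j = M (m + k)%N j.
  rewrite /Z ifN; last by lia.
  have -> : (m + k.*2.+1 - m = k.*2.+1)%N by lia.
  by rewrite /= odd_double /= uphalf_double.
have Zeven k j : Z (m + k.*2.+2)%N j = M (m + k).+1 j + u k * M (m + k)%N j.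
  rewrite /Z ifN; last by lia.
  have -> : (m + k.*2.+2 - m = k.*2.+2)%N by lia.
  by rewrite /= odd_double /= doubleK addnS.
have Zm j : Z m j = M m j by rewrite /Z leqnn.
have tpZ : tp Z.
  pose lo i := (minn i m + (i - m).-1./2)%N.
  apply: (tp_block Psr (lo := lo)) tpM => [i|i]; first by rewrite /lo; lia.
  case: (leqP i m) => [im|mi].
    apply: (@row_comb_ext _ _ _ _ _ _ (M i)) => [j|]; first by rewrite /Z im.
    by apply: row_comb_row => //; rewrite /lo; lia.
  have [k [ik|ik]] : exists k, (i = m + k.*2.+1)%N \/ (i = m + k.*2.+2)%N.
    by exists (i - m).-1./2; lia.
    apply: (@row_comb_ext _ _ _ _ _ _ (M (m + k)%N)) => [j|]; first by rewrite ik Zodd.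
    by apply: row_comb_row => //; rewrite /lo; lia.
  apply: (@row_comb_ext _ _ _ _ _ _
            (fun j => M (m + k).+1 j + u k * M (m + k)%N j)) => [j|].
    by rewrite ik Zeven.
  apply: row_combD => //; last apply: row_combZ => //.
    by apply: row_comb_row => //; rewrite /lo; lia.
  by apply: row_comb_row => //; rewrite /lo; lia.
pose lo i := (minn i m + (i - m).-1.*2)%N.
apply: (tp_block Psr (lo := lo)) tpZ => [i|i]; first by rewrite /lo; lia.
case: (leqP i m) => [im|mi].
  apply: (@row_comb_ext _ _ _ _ _ _ (Z i)) => [j|]; first by rewrite /Z im Nle.
  by apply: row_comb_row => //; rewrite /lo; lia.
have [k ik] : exists k, (i = (m + k).+1)%N by exists (i - m).-1; lia.
apply: (@row_comb_ext _ _ _ _ _ _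
  (fun j => Z (m + k.*2.+2)%N j + (v k * Z (m + k.*2)%N j + w k * Z (m + k.*2.+1)%N j))).
  move=> j; rewrite ik Ngt Zeven Zodd; case: k {ik} => [|k] /=.
    by rewrite double0 addn0 Zm; ring.
  by rewrite doubleS Zeven !addnS /=; ring.
apply: row_combD => //; last apply: row_combD => //; try apply: row_combZ => //;
by apply: row_comb_row => //; rewrite /lo; lia.
Qed.

(** The matrix [X m] has rows [F 0 0], ..., [F m 0], then [F m 1], [F m 2], and so on. Going from
    [m] to [m.+1] is one tridiagonal step that keeps the rows up to [m], and a given minor is stable
    once [m] bounds its row indices. *)
Lemma tp_level_zero (u v w : nat -> K) (F : nat -> nat -> nat -> K) :
    (forall k, P (u k)) -> (forall k, P (v k)) -> (forall k, P (w k)) ->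
    (forall m k j, F m.+1 k j = F m k.+1 j + (u k + v k + w k) * F m k j +
       down_weight u v k * F m k.-1 j) ->
  tp (F 0%N) -> tp (fun m j => F m 0%N j).
Proof.
move=> uP vP wP FE tpF0.
pose X m i j := F (minn i m) (i - m)%N j.
have tpX m : tp (X m).
  elim: m => [|m IHm].
    by apply: tp_ext tpF0 => i j; rewrite /X minn0 subn0.
  apply: (tp_tridiagonal (m := m) uP vP wP) IHm => [i j im|k j].
    by rewrite /X; congr F; lia.
  rewrite /X.
  have -> : minn (m + k).+1 m.+1 = m.+1 by lia.
  have -> : ((m + k).+1 - m.+1 = k)%N by lia.
  rewrite FE; have -> : minn (m + k).+1 m = m by lia.
  have -> : ((m + k).+1 - m = k.+1)%N by lia.
  have -> : minn (m + k) m = m by lia.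
  have -> : ((m + k) - m = k)%N by lia.
  case: k => [|k] /=; first by rewrite !mul0r.
  rewrite addnS /=; have -> : minn (m + k) m = m by lia.
  by have -> : ((m + k) - m = k)%N by lia.
move=> k r c r_inc c_inc.
have := tpX (\max_(i < k) r i) k r c r_inc c_inc; congr (P (\det _)).
apply/matrixP => i j; rewrite !mxE /X.
have ri : (r i <= \max_(i < k) r i)%N by apply: leq_bigmax.
by congr F; lia.
Qed.

(** Weighted Motzkin paths of [m] steps from level [k] to level [j], split at the first step: rises
    weigh 1, level steps [s], falls [t]. The truncated [k.-1] at level 0 is harmless once [t 0]
    vanishes. *)
Fixpoint path_sum (s t : nat -> K) (m k j : nat) : K :=
  if m is m'.+1 then
    path_sum s t m' k.+1 j + s k * path_sum s t m' k j +
    t k * path_sum s t m' k.-1 j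
  else (k == j)%:R.

(** Splitting at the last step instead of the first: powers of the tridiagonal matrix commute with
    it. *)
Lemma path_sum_last (s t : nat -> K) m k j : t 0%N = 0 ->
  path_sum s t m.+1 k j =
    (if j is j'.+1 then path_sum s t m k j' else 0) + s j * path_sum s t m k j +
    t j.+1 * path_sum s t m k j.+1.
Proof.
move=> t0; elim: m k j => [|m IHm] k j.
  have upE : (k.+1 == j)%:R = if j is j'.+1 then (k == j')%:R else 0 :> K.
    by case: j.
  have diagE : s k * (k == j)%:R = s j * (k == j)%:R by case: eqP => [->|]; rewrite ?mulr0.
  have downE : t k * (k.-1 == j)%:R = t j.+1 * (k == j.+1)%:R.
    case: k {upE diagE} => [|k]; first by rewrite t0 mul0r mulr0.
    by rewrite eqSS /=; case: eqP => [->|]; rewrite ?mulr0.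
  by rewrite /= upE diagE downE.
have E (a b : nat) : path_sum s t m.+2 a b = path_sum s t m.+1 a.+1 b +
  s a * path_sum s t m.+1 a b + t a * path_sum s t m.+1 a.-1 b by [].
rewrite [LHS]E (IHm k.+1 j) {1}(IHm k j) (IHm k.-1 j).
have E' (a b : nat) : path_sum s t m.+1 a b = path_sum s t m a.+1 b +
  s a * path_sum s t m a b + t a * path_sum s t m a.-1 b by [].
by case: j => [|j]; rewrite !E'; ring.
Qed.

(** No matrix product is formed: [tp_level_zero] is applied twice, first to the identity, giving
    [A], then to [D A^T]. The factor [d k], a product of fall weights, turns the last-step
    recurrence into the first-step form that lemma requires. *)
Lemma hankel_tp (u v w : nat -> K) :
    (forall k, P (u k)) -> (forall k, P (v k)) -> (forall k, P (w k)) ->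
  tp (fun i j => path_sum (fun k => u k + v k + w k) (down_weight u v) (i + j) 0 0).
Proof.
move=> uP vP wP; set s := (X in path_sum X); set t := down_weight u v.
have tpA : tp (fun m j => path_sum s t m 0 j).
  apply: (tp_level_zero (F := path_sum s t) uP vP wP) => //.
  exact: tp_id.
pose d k := \prod_(i < k) t i.+1.
have dP k : P (d k) by apply: cone_prod => // i _; apply: coneM.
have d0 : d 0%N = 1 by rewrite /d big_ord0.
pose F m k j := d k * path_sum s t (m + j) 0 k.
have FE m k j : F m.+1 k j = F m k.+1 j + s k * F m k j + t k * F m k.-1 j.
  rewrite /F addSn path_sum_last // /d; case: k => [|k].
    by rewrite /t /= !mul0r !big_ord1 big_ord0; ring.
  by rewrite !big_ord_recr /=; ring.
have tpF0 : tp (F 0%N).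
  exact: (tp_diag_mul Psr dP (tp_tr tpA)).
have := tp_level_zero uP vP wP FE tpF0.
by apply: tp_ext => i j; rewrite /F d0 mul1r.
Qed.

(** Rescaling column [k] by the product of the rise weights below it normalizes rises to 1; only the
    products [x k * y k] survive. *)
Lemma table_path_sum (x s y u v : nat -> K) (B : nat -> nat -> K) :
    (forall k, B 0%N k = (k == 0%N)%:R) ->
    (forall n k, B n.+1 k = (if k is k'.+1 then x k' * B n k' else 0) +
       s k * B n k + y k * B n k.+1) ->
    (forall k, x k * y k = u k * v k.+1) ->
  forall n k,
    B n k = (\prod_(i < k) x i) * path_sum s (down_weight u v) n 0 k.
Proof.
move=> B0 BS xy; elim=> [|n IHn] k.
  rewrite B0 /=; case: k => [|k]; first by rewrite big_ord0 mul1r.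
  by rewrite mulr0.
rewrite BS path_sum_last // !IHn; case: k => [|k].
  by rewrite big_ord1 big_ord0 /= -xy; ring.
by rewrite !IHn !big_ord_recr /= -xy; ring.
Qed.

(* The coefficients of the polynomials form a table with a tridiagonal
   production matrix. *)
Lemma hankel_tp_poly (c0 c1 d0 d1 d2 : K) (u v w : nat -> K) (p : nat -> {poly K}) :
    (forall k, P (u k)) -> (forall k, P (v k)) -> (forall k, P (w k)) ->
    p 0%N = 1 ->
    (forall n, p n.+1 = (c0%:P + c1 *: 'X) * p n +
       (d0%:P + d1 *: 'X + d2 *: 'X^2) * (p n)^`()) ->
    (forall k, c0 + k%:R * d1 = u k + v k + w k) ->
    (forall k, (c1 + k%:R * d2) * (k.+1%:R * d0) = u k * v k.+1) ->
  tp (fun i j => (p (i + j)%N)`_0).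
Proof.
move=> uP vP wP p0 pS sE tE.
apply: tp_ext (hankel_tp uP vP wP) => i j.
rewrite (@table_path_sum (fun k => c1 + k%:R * d2) (fun k => u k + v k + w k)
  (fun k => k.+1%:R * d0) u v (fun n k => (p n)`_k)) ?big_ord0 ?mul1r //.
  by move=> k; rewrite p0 coef1.
move=> n k; rewrite -sE pS !mulrDl -!scalerAl !coefD !coefZ !coefCM !coefXnM !coefXM.
have derivE l : (p n)^`()`_l = (p n)`_l.+1 * l.+1%:R by rewrite coef_deriv mulr_natr.
rewrite !derivE; case: k => [|[|k]]; rewrite ?subn2 [_.-1]/= ?[_.-2]/=.
- by move: (p n)`_0 (p n)`_1 => x y; rewrite /=; ring.
- by move: (p n)`_0 (p n)`_1 (p n)`_2 => x y z; rewrite /=; ring.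
- by move: (p n)`_k.+1 (p n)`_k.+2 (p n)`_k.+3 => x y z; rewrite /=; ring.
Qed.

End TridiagonalMatrices.

(** * Iterated log-convexity *)

Lemma det_expand_first_row (K : comNzRingType) (G : nat -> nat -> K) n :
  \det (\matrix_(i < n.+1, j < n.+1) G i j) =
  \sum_(0 <= j < n.+1) G 0%N j *
    ((-1) ^+ j * \det (\matrix_(i < n, k < n) G i.+1 (bump j k))).
Proof.
rewrite (expand_det_row _ ord0) big_mkord; apply: eq_bigr => j _.
rewrite mxE /cofactor add0n; congr (_ * (_ * \det _)).
by apply/matrixP => i k; rewrite !mxE.
Qed.

Lemma det2E (K : comNzRingType) (G : nat -> nat -> K) :
  \det (\matrix_(i < 2, j < 2) G i j) = G 0%N 0%N * G 1%N 1%N - G 0%N 1%N * G 1%N 0%N.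
Proof.
rewrite det_expand_first_row !big_nat_recr //= big_geq // !det_mx11 !mxE.
by rewrite /bump /=; ring.
Qed.

Lemma det3E (K : comNzRingType) (G : nat -> nat -> K) :
  \det (\matrix_(i < 3, j < 3) G i j) =
    G 0%N 0%N * (G 1%N 1%N * G 2%N 2%N - G 1%N 2%N * G 2%N 1%N)
  - G 0%N 1%N * (G 1%N 0%N * G 2%N 2%N - G 1%N 2%N * G 2%N 0%N)
  + G 0%N 2%N * (G 1%N 0%N * G 2%N 1%N - G 1%N 1%N * G 2%N 0%N).
Proof.
rewrite det_expand_first_row !big_nat_recr //= big_geq //.
by rewrite !(fun j => det2E (fun i k => G i.+1 (bump j k))) /bump /=; ring.
Qed.

Lemma det4E (K : comNzRingType) (G : nat -> nat -> K) :
  \det (\matrix_(i < 4, j < 4) G i j) =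
  let m j0 j1 j2 :=
      G 1%N j0 * (G 2%N j1 * G 3%N j2 - G 2%N j2 * G 3%N j1)
    - G 1%N j1 * (G 2%N j0 * G 3%N j2 - G 2%N j2 * G 3%N j0)
    + G 1%N j2 * (G 2%N j0 * G 3%N j1 - G 2%N j1 * G 3%N j0) in
  G 0%N 0%N * m 1%N 2%N 3%N - G 0%N 1%N * m 0%N 2%N 3%N
  + G 0%N 2%N * m 0%N 1%N 3%N - G 0%N 3%N * m 0%N 1%N 2%N.
Proof.
rewrite det_expand_first_row !big_nat_recr //= big_geq //.
by rewrite !(fun j => det3E (fun i k => G i.+1 (bump j k))) /bump /=; ring.
Qed.

(* [L^2] is the middle term times a Hankel minor of order 3, and by Dodgson
   condensation [L^3] is a sum of products of Hankel minors of order at most 4. *)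
Lemma log_convex3_tp (K : comNzRingType) (P : K -> Prop) (alpha : nat -> K) :
    semiring_pred P -> tp P (fun i j => alpha (i + j)%N) ->
  forall l i, (l <= 3)%N -> (l <= i)%N -> P (iter l (@logop K) alpha i).
Proof.
move=> Psr tpH l i.
pose h m i j := alpha (m + i + j)%N.
have minor d m : P (\det (\matrix_(a < d, b < d) h m a b)).
  apply: (tpH d (fun a => m + a)%N (fun b => b : nat)) => // a b.
  by rewrite ltn_add2l.
have P0 m : P (alpha m).
  by have := minor 1%N m; rewrite det_mx11 mxE /h !addn0.
have P1 m : P (logop alpha m.+1).
  by have := minor 2%N m; rewrite det2E /h !addnS !addn0; congr (P _).
have P2 m : P (iter 2 (@logop K) alpha m.+2).
  have := coneM Psr (P0 m.+2) (minor 3%N m).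
  by rewrite det3E /h !addnS !addn0; congr (P _); rewrite /= /logop /=; ring.
have P3 m : P (iter 3 (@logop K) alpha m.+3).
  (* Put [i = m + 3] and let [H_i] be the order-3 minor centred at [alpha i]. Then [L^3] is
     [L[alpha i] H_(i-1) H_(i+1) + (alpha i)^2 (H_(i-1) H_(i+1) - H_i^2)], and Dodgson turns the
     last bracket into the order-4 minor times [L[alpha i]]. *)
  have := coneD Psr (coneM Psr (P1 m.+2) (coneM Psr (minor 3%N m) (minor 3%N m.+2)))
    (coneM Psr (coneM Psr (P0 m.+3) (P0 m.+3)) (coneM Psr (minor 4%N m) (P1 m.+2))).
  rewrite (det4E (h m)) (det3E (h m)) (det3E (h m.+2)) /h /=.
  rewrite !addnS !addn0 ?addSn; congr (P _); rewrite /logop /=.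
  move: (alpha m) (alpha m.+1) (alpha m.+2) (alpha m.+3) (alpha m.+4)
    (alpha m.+4.+1) (alpha m.+4.+2) => a b c d e f g; ring.
case: l => [|[|[|[|//]]]] _; first by move=> _; apply: P0.
- by case: i => // i _; apply: P1.
- by case: i => [|[|i]] // _; apply: P2.
- by case: i => [|[|[|i]]] // _; apply: P3.
Qed.

(** * Row polynomials *)

(** The weights [z] stay arbitrary so that both lines and the square-root curve can be substituted;
    the boundary terms vanish by triangularity. *)
Lemma sum_row_recurrence (K : comNzRingType) (f g : K -> K -> K) (T : nat -> int -> K)
    (z : nat -> {poly K}) n :
  triangular T -> recurrence f g T ->
  \sum_(k < n.+2) (T n.+1 k%:Z)%:P * z k =
  \sum_(k < n.+1) (T n k%:Z)%:P *
    ((f n.+1%:R k%:R)%:P * z k + (g n.+1%:R k.+1%:R)%:P * z k.+1).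
Proof.
move=> [_ T0] TS.
have TE k : (T n.+1 k%:Z)%:P * z k = (T n k%:Z)%:P * ((f n.+1%:R k%:R)%:P * z k) +
    (g n.+1%:R k%:R)%:P * (T n (k%:Z - 1))%:P * z k.
  by rewrite TS // -!pmulrn polyCD !polyCM; ring.
under eq_bigr do rewrite TE.
rewrite big_split /= big_ord_recr /= T0 ?polyC0 ?mul0r ?addr0; last by lia.
rewrite [X in _ + X]big_ord_recl /= [T n (0 - 1)]T0 // polyC0 mulr0 mul0r add0r.
rewrite -big_split /=; apply: eq_bigr => k _.
have -> : (bump 0 k)%:Z - 1 = k%:Z by rewrite /bump /=; lia.
by rewrite /bump /= mulrDr; ring.
Qed.

Section Rows.

Variables (K : comNzRingType) (P : K -> Prop) (u v w : nat -> K).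
Hypothesis (Psr : semiring_pred P).
Hypothesis (uP : forall k, P (u k)) (vP : forall k, P (v k)) (wP : forall k, P (w k)).

(* Evaluating the homogenized row polynomials along the line
   [X |-> (1 + y X, q (1 + z X))] turns the recurrence of the array into a first
   order differential recurrence. *)
Lemma row_poly_tp (f g : K -> K -> K) (T : nat -> int -> K) (q y z : K)
    (c0 c1 d0 d1 d2 : K) (ey ez : {poly K}) :
  let Y := 1 + y *: 'X in let Z := q%:P * (1 + z *: 'X) in
  let d := d0%:P + d1 *: 'X + d2 *: 'X^2 in
  triangular T -> recurrence f g T ->
  d * y%:P = ey * Y -> d * (q * z)%:P = ez * Z ->
  (forall l k, (f (k + l).+1%:R k%:R)%:P * Y + (g (k + l).+1%:R k.+1%:R)%:P * Z =
     c0%:P + c1 *: 'X + ey *+ l + ez *+ k) ->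
  (forall k, c0 + k%:R * d1 = u k + v k + w k) ->
  (forall k, (c1 + k%:R * d2) * (k.+1%:R * d0) = u k * v k.+1) ->
  tp P (fun i j => row_poly q T (i + j)).
Proof.
move=> Y Z d Ttri Trec dY dZ fgE sE tE.
(* [ey] and [ez] are the logarithmic derivatives of [Y] and [Z] along [d], so powers are
   eigenvectors up to a multiple. *)
have dexp (W e : {poly K}) m : d * W^`() = e * W -> d * (W ^+ m)^`() = e * W ^+ m *+ m.
  move=> dW; rewrite deriv_exp mulrnAr; case: m => [|m]; first by rewrite !mulr0n.
  by rewrite mulrA dW exprS mulrA.
have Y' : Y^`() = y%:P by rewrite /Y derivD derivC derivZ derivX add0r alg_polyC.
have Z' : Z^`() = (q * z)%:P.
  by rewrite /Z derivM derivC derivD derivC derivZ derivX mul0r !add0r alg_polyC polyCM.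
rewrite -Y' in dY; rewrite -Z' in dZ.
pose p n := \sum_(k < n.+1) (T n k%:Z)%:P * (Y ^+ (n - k) * Z ^+ k).
have p0 : p 0%N = 1 by rewrite /p big_ord1 Ttri.1 !expr0 !mulr1.
have pS n : p n.+1 = (c0%:P + c1 *: 'X) * p n + d * (p n)^`().
  rewrite /p (sum_row_recurrence (fun k => Y ^+ (n.+1 - k) * Z ^+ k) n Ttri Trec).
  rewrite raddf_sum /= !mulr_sumr -big_split /=.
  apply: eq_bigr => k _; rewrite derivM derivC mul0r add0r derivM.
  have [l nl] : exists l, n = (k + l)%N by exists (n - k)%N; have := ltn_ord k; lia.
  have -> : (n.+1 - k = l.+1)%N by lia.
  have -> : (n.+1 - k.+1 = l)%N by lia.
  have -> : (n - k = l)%N by lia.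
  have := fgE l k; rewrite -nl => E.
  transitivity ((T n k)%:P * (Y ^+ l * Z ^+ k) *
    (c0%:P + c1 *: 'X + ey *+ l + ez *+ k)).
    by rewrite -E !exprS; ring.
  have := dexp _ _ l dY; have := dexp _ _ k dZ.
  move: (Y ^+ l) (Z ^+ k) (Y ^+ l)^`() (Z ^+ k)^`() => Yl Zk Yl' Zk' eZ eY.
  transitivity ((c0%:P + c1 *: 'X) * ((T n k)%:P * (Yl * Zk)) +
    (T n k)%:P * (d * Yl' * Zk + Yl * (d * Zk'))); last by ring.
  rewrite eZ eY; ring.
apply: tp_ext (hankel_tp_poly Psr uP vP wP p0 pS sE tE) => i j.
rewrite /p /row_poly coef_sum; apply: eq_bigr => k _.
rewrite coefCM; congr (_ * _); rewrite -horner_coef0 hornerM !horner_exp.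
by rewrite /Y /Z !hornerE ?expr1n ?mul1r ?mulr1.
Qed.

(** The polynomials [alpha n * (1 + X)^n] satisfy the differential recurrence with coefficients
    [b (1 + X)] and [a (1 + X)^2]. *)
Lemma rising_factorial_tp (a b : K) (alpha : nat -> K) :
  alpha 0%N = 1 -> (forall n, alpha n.+1 = (b + n%:R * a) * alpha n) ->
  (forall k, b + k%:R * (2 * a) = u k + v k + w k) ->
  (forall k, (b + k%:R * a) * (k.+1%:R * a) = u k * v k.+1) ->
  tp P (fun i j => alpha (i + j)%N).
Proof.
move=> a0 aS sE tE; pose p n := (alpha n)%:P * (1 + 'X) ^+ n.
have p0 : p 0%N = 1 by rewrite /p a0 mulr1.
have pS n : p n.+1 = (b%:P + b *: 'X) * p n +
    (a%:P + (2 * a) *: 'X + a *: 'X^2) * (p n)^`().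
  rewrite /p aS derivM derivC mul0r add0r deriv_exp derivD derivX derivC add0r mul1r.
  rewrite -!mul_polyC; case: n => [|n]; first by rewrite !expr0 expr1; ring.
  by rewrite [n.+1.-1]/= !exprS; ring.
apply: tp_ext (hankel_tp_poly Psr uP vP wP p0 pS sE tE) => i j.
by rewrite /p coefCM -horner_coef0 !hornerE expr1n mulr1.
Qed.

End Rows.

(** In the induction step the terms not divisible by [b2 + n (b0 + b1)] carry the factor [b1] and
    cancel by [(k+1) C(n,k+1) = (n-k) C(n,k)]. *)
Lemma rec_ii_entry (K : comNzRingType) (a0 b0 b1 b2 : K) (T : nat -> int -> K) n k :
  triangular T -> rec_ii a0 b0 b1 b2 T -> (k <= n)%N ->
  T n k%:Z = 'C(n, k)%:R * a0 ^+ (n - k) * \prod_(i < n) (b2 + i%:R * (b0 + b1)).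
Proof.
move=> [T00 T0] TS; elim: n k => [|n IHn] k.
  by case: k => // _; rewrite T00 big_ord0 bin0 expr0 !mulr1.
have Tn k' : T n k'%:Z = 'C(n, k')%:R * a0 ^+ (n - k') *
    \prod_(i < n) (b2 + i%:R * (b0 + b1)).
  case: (leqP k' n) => [/IHn //|lt_nk]; rewrite bin_small // !mul0r T0 //; lia.
move=> kn; rewrite TS //= big_ord_recr /=.
case: k kn => [_|k kn].
  rewrite (T0 _ (0 - 1)) // Tn !subn0 !bin0 exprS -natr1; ring.
have -> : k.+1%:Z - 1 = k%:Z by lia.
rewrite !Tn binS subSS natrD -!pmulrn -!natr1.
have [l nl] : exists l, n = (k + l)%N by exists (n - k)%N; lia.
have := mul_bin_left n k; rewrite nl; have -> : (k + l - k = l)%N by lia.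
case: l {nl} => [|l] /(congr1 (fun m => m%:R : K)); rewrite !natrM -natr1.
  by move=> _; rewrite bin_small ?addn0 //; ring.
have -> : (k + l.+1 - k.+1 = l)%N by lia.
rewrite exprS natrD -!natr1; move: ('C(_, k.+1)%:R) ('C(_, k)%:R) => C1 C0 E.
move: (\prod_(i < _) _) => p; apply/subr0_eq.
transitivity (((k%:R + 1) * C1 - (l%:R + 1) * C0) * (b1 * a0 * a0 ^+ l * p)).
  by ring.
by rewrite E subrr mul0r.
Qed.

Lemma rec_ii_row_poly (K : comNzRingType) (a0 b0 b1 b2 q : K) (T : nat -> int -> K) n :
  triangular T -> rec_ii a0 b0 b1 b2 T ->
  row_poly q T n = \prod_(i < n) ((a0 + q) * b2 + i%:R * ((a0 + q) * (b0 + b1))).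
Proof.
move=> Ttri Trec.
have -> : \prod_(i < n) ((a0 + q) * b2 + i%:R * ((a0 + q) * (b0 + b1))) =
    (a0 + q) ^+ n * \prod_(i < n) (b2 + i%:R * (b0 + b1)).
  have -> : (a0 + q) ^+ n = \prod_(i < n) (a0 + q) by rewrite prodr_const card_ord.
  rewrite -big_split /=; apply: eq_bigr => i _; ring.
rewrite exprDn mulr_suml; apply: eq_bigr => k _.
have le_kn : (k <= n)%N by rewrite -ltnS.
rewrite (rec_ii_entry Ttri Trec le_kn) -[X in _ = X * _]mulr_natl.
move: ('C(n, k)%:R) (a0 ^+ _) (q ^+ _) (\prod_(i < n) _) => c x y p; ring.
Qed.

(** * Row polynomials along a level set of a quadratic invariant *)

Section SquareRootCurve.

Variables (K : idomainType) (P : K -> Prop) (a1 a2 p0 q0 h rho : K).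
Hypothesis Psr : semiring_pred P.
Hypotheses (Pa1 : P a1) (Pa2 : P a2) (Pp0 : P p0) (Pq0 : P q0).

Let e := p0 + 2 * q0.
Hypotheses (e_neq0 : e != 0) (h_rho : 2 * h * rho = q0 * e).

(* A parametrization, with parameter [z = p + 2 Q], of the level set
   [p (p + 2 Q) = p0 e], rescaled by [z] to be polynomial: the point [(p, Q)] is
   [(p0 e, 2 h r) / z], where [z] and [r] take the values [e] and [rho] at [0]. *)
Definition curve_z : {poly K} := e%:P + (2 * h) *: 'X.
Definition curve_r : {poly K} := rho%:P + e *: 'X + h *: 'X^2.
Local Notation Z := curve_z.
Local Notation R := curve_r.

(** This is [z = p + 2 Q] on the curve, multiplied by [z]. *)
Lemma curve_zE : Z ^+ 2 = (p0 * e)%:P + (2 * (2 * h))%:P * R.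
Proof.
have E : (2 * h)%:P * rho%:P = (q0 * e)%:P :> {poly K} by rewrite -polyCM h_rho.
have -> : Z ^+ 2 = (p0 * e)%:P + 2 * (q0 * e)%:P + (2 * (2 * h))%:P * (R - rho%:P).
  by rewrite /Z /R /e -!mul_polyC; ring.
by rewrite -E; ring.
Qed.

Lemma deriv_curve_r : R^`() = Z.
Proof.
rewrite /R !derivD derivC add0r !derivZ derivX derivXn /= expr1 -!mul_polyC.
by rewrite /Z -mul_polyC; ring.
Qed.

Lemma curve_r0 : R.[0] = rho.
Proof.
by rewrite /R !(hornerD, hornerZ, hornerC, hornerX, hornerXn) expr0n !mulr0 !addr0.
Qed.

(** [kappa n] stands for [R r' / Z] without dividing. Writing [r n = Z^n p n] absorbs the term with
    [n] and leaves [p n.+1 = a2 Z p + a1 R p']; at 0 the factor [e^n] cancels. *)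
Lemma square_root_curve_tp (alpha : nat -> K) (r kappa : nat -> {poly K}) :
    r 0%N = 1 -> (forall n, (r n)`_0 = e ^+ n * alpha n) ->
    (forall n, R * (r n)^`() = Z * kappa n) ->
    (forall n, r n.+1 = a2%:P * Z ^+ 2 * r n +
       a1%:P * (Z ^+ 2 * kappa n - (n%:R * (2 * h))%:P * R * r n)) ->
  tp P (fun i j => alpha (i + j)%N).
Proof.
move=> r0 r_alpha r'E rS.
pose L (p : {poly K}) : {poly K} := ((a2 * e)%:P + (a2 * (2 * h)) *: 'X) * p +
  ((a1 * rho)%:P + (a1 * e) *: 'X + (a1 * h) *: 'X^2) * p^`().
have LE p : L p = a2%:P * Z * p + a1%:P * R * p^`().
  by rewrite /L /Z /R -!mul_polyC !polyCM; ring.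
pose p n := iter n L 1.
have rE n : r n = Z ^+ n * p n.
  elim: n => [|n IHn]; first by rewrite r0 mulr1.
  rewrite rS /p iterS -/(p n) LE.
  have -> : Z ^+ 2 * kappa n = Z * (R * (r n)^`()) by rewrite r'E; ring.
  have -> : Z * (R * (r n)^`()) = (n%:R * (2 * h))%:P * R * r n + Z ^+ n.+1 * R * (p n)^`().
    have Z' : Z^`() = (2 * h)%:P by rewrite /Z derivD derivC add0r derivZ derivX alg_polyC.
    rewrite IHn derivM deriv_exp Z' polyCM polyC_natr.
    case: (n) => [|m]; first by rewrite expr0 !mulr0n expr1; ring.
    by rewrite [m.+1.-1]/= -mulr_natr !exprS; ring.
  by rewrite IHn !exprS; ring.
(* The factorization depends on the parity of [k] because [1 / 2] need not be
     available among the coefficients. *)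
pose u k := if odd k then (2 * a2 + k%:R * a1) * q0 else (a2 + k./2%:R * a1) * e.
pose v k := if odd k then k%:R * a1 * q0 else k./2%:R * a1 * e.
pose w k := if odd k then (a2 + k%:R * a1) * p0 else 0.
have Pe : P e by rewrite /e; cone Psr.
have uP k : P (u k) by rewrite /u; case: odd; cone Psr.
have vP k : P (v k) by rewrite /v; case: odd; cone Psr.
have wP k : P (w k) by rewrite /w; case: odd; cone Psr.
have half_nat k : k%:R = (odd k)%:R + 2 * k./2%:R :> K.
  by rewrite -[in LHS](odd_double_half k) natrD -muln2 natrM mulrC.
have sE k : a2 * e + k%:R * (a1 * e) = u k + v k + w k.
  rewrite /u /v /w; case: (boolP (odd k)) => ok; first by rewrite /e; ring.
  by rewrite (half_nat k) (negbTE ok) /=; ring.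
have tE k : (a2 * (2 * h) + k%:R * (a1 * h)) * (k.+1%:R * (a1 * rho)) = u k * v k.+1.
  transitivity ((2 * a2 + k%:R * a1) * k.+1%:R * a1 * (h * rho)); first by ring.
  have e2 : 2 * (h * rho) = q0 * e by rewrite mulrA.
  rewrite /u /v /= uphalf_half; case: (boolP (odd k)) => ok /=.
    rewrite natrD -[k.+1%:R]natr1 (half_nat k) ok /=.
    transitivity ((2 * a2 + (1 + 2 * (k./2)%:R) * a1) * (1 + (k./2)%:R) * a1 *
      (2 * (h * rho))); first by ring.
    by rewrite e2; ring.
  rewrite -[k.+1%:R]natr1 (half_nat k) (negbTE ok) /=.
  transitivity ((a2 + (k./2)%:R * a1) * (2 * (k./2)%:R + 1) * a1 *
      (2 * (h * rho))); first by ring.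
  by rewrite e2; ring.
apply: tp_ext (hankel_tp_poly Psr uP vP wP (erefl : p 0%N = 1) (fun n => erefl) sE tE)
  => i j.
apply: (mulfI (expf_neq0 (i + j) e_neq0)).
rewrite -r_alpha rE -!horner_coef0 hornerM horner_exp.
by rewrite /Z !hornerE.
Qed.

(** [j n k] is the exponent of the coordinate [r / z], the other coordinate being [p = p0 e / z];
    multiplying by [Z^n] clears denominators. *)
Lemma curve_row_poly_tp (f g : K -> K -> K) (T : nat -> int -> K) (q : K)
    (j : nat -> nat -> nat) :
  let z n k := ((p0 * e)%:P) ^+ (n - j n k) * R ^+ j n k in
  triangular T -> recurrence f g T -> j 0%N 0%N = 0%N ->
  (forall n k, (k <= n)%N -> (z n k)`_0 = e ^+ n * q ^+ k) ->
  (forall n k, (k <= n)%N ->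
     (f n.+1%:R k%:R)%:P * z n.+1 k + (g n.+1%:R k.+1%:R)%:P * z n.+1 k.+1 =
     (a2%:P * Z ^+ 2 +
      a1%:P * ((j n k)%:R * Z ^+ 2 - (n%:R * (2 * h))%:P * R)) * z n k) ->
  tp P (fun i j => row_poly q T (i + j)).
Proof.
move=> z Ttri Trec j0 z0 fgE.
pose r n := \sum_(k < n.+1) (T n k%:Z)%:P * z n k.
pose kappa n := \sum_(k < n.+1) (T n k%:Z)%:P * ((j n k)%:R * z n k).
apply: (@square_root_curve_tp (row_poly q T) r kappa) => [|n|n|n].
- by rewrite /r big_ord1 Ttri.1 /z j0 !mul1r.
- rewrite /r /row_poly coef_sum mulr_sumr; apply: eq_bigr => k _.
  have le_kn : (k <= n)%N by rewrite -ltnS.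
  by rewrite coefCM z0 //; ring.
- rewrite /r /kappa raddf_sum /= !mulr_sumr; apply: eq_bigr => k _.
  rewrite derivM derivC mul0r add0r /z -polyC_exp derivM derivC mul0r add0r.
  transitivity ((T n k)%:P * ((p0 * e) ^+ (n - j n k))%:P * (R * (R ^+ j n k)^`())).
    by ring.
  rewrite deriv_exp deriv_curve_r; case: (j n k) => [|m]; first by rewrite mulr0n; ring.
  by rewrite [m.+1.-1]/= exprS -mulr_natr; ring.
- rewrite /r (sum_row_recurrence (z n.+1) n Ttri Trec) /kappa !mulr_sumr.
  rewrite -sumrB mulr_sumr -big_split; apply: eq_bigr => k _ /=.
  have le_kn : (k <= n)%N by rewrite -ltnS.
  by rewrite fgE //; ring.
Qed.

End SquareRootCurve.

(** * Recurrences (i) to (v) *)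

Section Recurrences.

Variables (K : comNzRingType) (P : K -> Prop) (a0 a1 a2 b0 b1 b2 q : K).
Hypothesis Psr : semiring_pred P.
Hypotheses (Pa0 : P a0) (Pa1 : P a1) (Pa2 : P a2).
Hypotheses (Pb0 : P b0) (Pb1 : P b1) (Pb2 : P b2) (Pq : P q).
Variable T : nat -> int -> K.
Hypothesis Ttri : triangular T.

(** The weights depend on [n] alone, so the line is radial and scales both variables together. *)
Lemma rec_i_tp : rec_i a0 a2 b0 b2 T -> tp P (fun i j => row_poly q T (i + j)).
Proof.
move=> Trec; pose a := a0 + b0 * q; pose b := a2 + b2 * q.
apply: (@row_poly_tp K P (fun k => b + k%:R * a) (fun k => k%:R * a) (fun=> 0) Psr
  _ _ _ _ _ T q 1 1 b b a (2 * a) a (a%:P + a *: 'X) (a%:P + a *: 'X) Ttri Trec).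
- by move=> k; rewrite /a /b; cone Psr.
- by move=> k; rewrite /a /b; cone Psr.
- by move=> k; cone Psr.
- by rewrite -!mul_polyC; ring.
- by rewrite -!mul_polyC; ring.
- by move=> l k; rewrite /a /b -!mul_polyC -!natr1 !natrD; ring.
- by move=> k; ring.
- by move=> k; ring.
Qed.

Lemma rec_ii_tp : rec_ii a0 b0 b1 b2 T -> tp P (fun i j => row_poly q T (i + j)).
Proof.
move=> Trec; pose a := (a0 + q) * (b0 + b1); pose b := (a0 + q) * b2.
apply: (@rising_factorial_tp K P (fun k => b + k%:R * a) (fun k => k%:R * a) (fun=> 0) Psr
  _ _ _ a b (row_poly q T)).
- by move=> k; rewrite /a /b; cone Psr.
- by move=> k; rewrite /a /b; cone Psr.
- by move=> k; cone Psr.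
- by rewrite (rec_ii_row_poly _ _ Ttri Trec) big_ord0.
- by move=> n; rewrite !(rec_ii_row_poly _ _ Ttri Trec) big_ord_recr [RHS]mulrC.
- by move=> k; ring.
- by move=> k; ring.
Qed.

(** The weights depend on [k] alone, so only the second variable moves. *)
Lemma rec_iii_tp : rec_iii a1 a2 b1 b2 T -> tp P (fun i j => row_poly q T (i + j)).
Proof.
move=> Trec; pose a := a1 + b1 * q.
apply: (@row_poly_tp K P (fun k => (b2 + k%:R * b1) * q) (fun k => k%:R * a) (fun=> a2) Psr
  _ _ _ _ _ T q 0 1 (a2 + b2 * q) (b2 * q) a (a + b1 * q) (b1 * q)
  0 (a%:P + (b1 * q) *: 'X) Ttri Trec).
- by move=> k; cone Psr.
- by move=> k; rewrite /a; cone Psr.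
- by [].
- by rewrite mulr0 mul0r.
- by rewrite -!mul_polyC; ring.
- by move=> l k; rewrite /a -!mul_polyC -!natr1 mul0rn; ring.
- by move=> k; rewrite /a; ring.
- by move=> k; rewrite /a; ring.
Qed.

(** The weights depend on [n - k] alone, so only the first variable moves. *)
Lemma rec_iv_tp : rec_iv a0 a2 b0 b2 T -> tp P (fun i j => row_poly q T (i + j)).
Proof.
move=> Trec; pose a := a0 + b0 * q.
apply: (@row_poly_tp K P (fun k => a2 + k%:R * a0) (fun k => k%:R * a) (fun=> b2 * q) Psr
  _ _ _ _ _ T q 1 0 (a2 + b2 * q) a2 a (a + a0) a0
  (a%:P + a0 *: 'X) 0 Ttri Trec).
- by move=> k; cone Psr.
- by move=> k; rewrite /a; cone Psr.
- by move=> k; cone Psr.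
- by rewrite -!mul_polyC; ring.
- by rewrite mulr0 mulr0 mul0r.
- by move=> l k; rewrite /a -!mul_polyC -!natr1 natrD mul0rn; ring.
- by move=> k; rewrite /a; ring.
- by move=> k; rewrite /a; ring.
Qed.

(** Each special case lets [a2 b0 + b2 a1 + k a1 b0], times [k + 1], split into linear factors [u k]
    and [v k.+1] that also add up to the diagonal. *)
Lemma rec_v_tp : 0 \in [:: a2; b2; a1 - a2; b0 - b2] ->
  rec_v a1 a2 b0 b2 T -> tp P (fun i j => row_poly q T (i + j)).
Proof.
move=> special Trec.
have main u v : (forall k, P (u k)) -> (forall k, P (v k)) ->
    (forall k, a2 + b2 * q + k%:R * (b0 * q + a1) = u k + v k + 0) ->
    (forall k, (a2 * (b0 * q) + b2 * q * a1 + k%:R * (a1 * b0 * q)) * (k.+1%:R * 1) =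
       u k * v k.+1) ->
    tp P (fun i j => row_poly q T (i + j)).
  move=> Pu Pv.
  apply: (@row_poly_tp K P u v (fun=> 0) Psr Pu Pv _ _ _ T q (b0 * q) a1
    (a2 + b2 * q) (a2 * (b0 * q) + b2 * q * a1) 1 (b0 * q + a1) (a1 * b0 * q)
    ((b0 * q)%:P + (b0 * q * a1) *: 'X) (a1%:P + (a1 * b0 * q) *: 'X) Ttri Trec).
  - by move=> k; cone Psr.
  - by rewrite -!mul_polyC; ring.
  - by rewrite -!mul_polyC; ring.
  - by move=> l k; rewrite -!mul_polyC -!natr1 natrD; ring.
move: special; rewrite !inE => /or4P[] /eqP e.
- apply: (main (fun k => (b2 + k%:R * b0) * q) (fun k => k%:R * a1)) => k;
  by [cone Psr | rewrite -e; ring].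
- apply: (main (fun k => a2 + k%:R * a1) (fun k => k%:R * (b0 * q))) => k;
  by [cone Psr | rewrite -e; ring].
- have e' : a2 = a1 by apply/eqP; rewrite eq_sym -subr_eq0 -e.
  apply: (main (fun k => k.+1%:R * a1) (fun k => (b2 + k%:R * b0) * q)) => k;
  by [cone Psr | rewrite e'; ring].
- have e' : b2 = b0 by apply/eqP; rewrite eq_sym -subr_eq0 -e.
  apply: (main (fun k => k.+1%:R * (b0 * q)) (fun k => a2 + k%:R * a1)) => k;
  by [cone Psr | rewrite e'; ring].
Qed.

End Recurrences.

(** * Recurrences (vi) and (vii) *)

Lemma add_double_quotient_neq0 (K : fieldType) (a b c : K) :
  a != 0 -> c * a + b *+ 2 != 0 -> c + 2 * (b / a) != 0.
Proof.
move=> a_neq0; apply: contra_neq => e0.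
have -> : c * a + b *+ 2 = (c + 2 * (b / a)) * a by field.
by rewrite e0 mul0r.
Qed.

Section QuotientRecurrences.

Variables (K : fieldType) (P : K -> Prop) (a1 a2 b0 q : K).
Hypothesis Psr : semiring_pred P.
Hypotheses (two_neq0 : 2 != 0 :> K) (a1_neq0 : a1 != 0).
Hypotheses (Pa1 : P a1) (Pa2 : P a2) (Pq : P q) (Pb : P (b0 / a1)).
Variable T : nat -> int -> K.
Hypothesis Ttri : triangular T.

Lemma rec_vi_tp : q + 2 * (b0 / a1) != 0 ->
  rec_vi a1 a2 b0 T -> tp P (fun i j => row_poly q T (i + j)).
Proof.
set b := b0 / a1 => e_neq0 Trec; set e := q + 2 * b in e_neq0.
have h2 : 2 * (b / 2) = b by field.
have h2e : 2 * (b / 2) * e = b * e by rewrite h2.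
(* With [h = b / 2] one has [Q = b (r / z)]; [rho = e] makes [(r / z, p)] start at [(1, q)]. *)
apply: (@curve_row_poly_tp K P a1 a2 q b (b / 2) e Psr Pa1 Pa2 Pq Pb e_neq0 h2e
  _ _ T q (fun n k => n - k)%N Ttri Trec) => [|n k kn|n k kn].
- by [].
- rewrite subKn // -/e -horner_coef0 hornerM !horner_exp hornerC curve_r0.
  by rewrite exprMn -mulrA -exprD subnKC // mulrC.
have [l nl] : exists l, n = (k + l)%N by exists (n - k)%N; lia.
have -> : (n.+1 - k = l.+1)%N by lia.
have -> : (n.+1 - l.+1 = k)%N by lia.
have -> : (n.+1 - k.+1 = l)%N by lia.
have -> : (n.+1 - l = k.+1)%N by lia.
have -> : (n - k = l)%N by lia.
have -> : (n - l = k)%N by lia.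
have -> : b0 * (n.+1%:R - 2 * k%:R + (2 * a2 - a1) / a1) = b * (a1 * (l%:R - k%:R) + 2 * a2).
  by rewrite nl -natr1 natrD /b; field.
have -> : a1 * (n.+1%:R - k.+1%:R) + a2 = a1 * l%:R + a2.
  by rewrite nl -!natr1 natrD; ring.
rewrite (curve_zE h2e).
rewrite -/e h2 nl natrD !exprS; move: (curve_r _ _ _ _) => R.
move: (_ ^+ k) (R ^+ l) => Ck Rl; ring.
Qed.

Lemma rec_vii_tp : 1 + 2 * (b0 / a1 * q) != 0 ->
  rec_vii a1 a2 b0 T -> tp P (fun i j => row_poly q T (i + j)).
Proof.
set b := b0 / a1 => e_neq0 Trec; set e := 1 + 2 * (b * q) in e_neq0.
have h2 : 2 * (b / 2) = b by field.
have h2e : 2 * (b / 2) * (q * e) = b * q * e by rewrite h2 mulrA.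
(* Here the roles are exchanged: [(p, r / z)] starts at [(1, q)]. *)
apply: (@curve_row_poly_tp K P a1 a2 1 (b * q) (b / 2) (q * e) Psr Pa1 Pa2
  (cone1 Psr) (coneM Psr Pb Pq) e_neq0 h2e
  _ _ T q (fun n k => k) Ttri Trec) => [|n k kn|n k kn].
- by [].
- rewrite -/e mul1r -horner_coef0 hornerM !horner_exp hornerC curve_r0.
  by rewrite exprMn mulrCA -exprD subnK // mulrC.
have [l nl] : exists l, n = (k + l)%N by exists (n - k)%N; lia.
have -> : (n.+1 - k = l.+1)%N by lia.
have -> : (n.+1 - k.+1 = l)%N by lia.
have -> : (n - k = l)%N by lia.
have -> : b0 * (2 * k.+1%:R - n.+1%:R + (2 * a2 - a1) / a1) = b * (a1 * (k%:R - l%:R) + 2 * a2).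
  by rewrite nl -!natr1 natrD /b; field.
rewrite (curve_zE h2e).
rewrite -/e h2 nl natrD !exprS; move: (curve_r _ _ _ _) => R.
move: (R ^+ k) ((_%:P) ^+ l) => Rk Cl; ring.
Qed.

End QuotientRecurrences.

(** * Nonnegative coefficients in the field of rational functions *)

Definition ratfun_const (R : realDomainType) (c : R) : ratfun R :=
  tofrac (c%:MP : {mpoly R[7]}).

HB.instance Definition _ (R : realDomainType) :=
  GRing.RMorphism.copy (@ratfun_const R)
    (@tofrac ({mpoly R[7]} : idomainType) \o @mpolyC 7 R).

Section CoefNonneg.

Variables (R : realDomainType) (m : nat) (y : m.-tuple (ratfun R)).

Lemma coef_ge0_semiring : semiring_pred (coef_ge0 y).
Proof.
split.
- by exists 0; split=> [e|]; rewrite ?mcoeff0 // -/(@ratfun_const R) rmorph0.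
- exists 1; split=> [e|]; last by rewrite -/(@ratfun_const R) rmorph1.
  by rewrite mcoeff1 ler0n.
- move=> _ _ [f [f0 ->]] [g [g0 ->]]; exists (f + g).
  by split=> [e|]; rewrite ?mcoeffD ?addr_ge0 // -/(@ratfun_const R) rmorphD.
- move=> _ _ [f [f0 ->]] [g [g0 ->]]; exists (f * g).
  split=> [e|]; last by rewrite -/(@ratfun_const R) rmorphM.
  by rewrite mcoeffM sumr_ge0 // => i _; rewrite mulr_ge0.
Qed.

Lemma coef_ge0_nth i : (i < m)%N -> coef_ge0 y (nth 0 y i).
Proof.
move=> im; exists 'X_(Ordinal im); split=> [e|]; first by rewrite mcoeffX ler0n.
by rewrite -/(@ratfun_const R) mmapX mmap1U (tnth_nth 0).
Qed.

End CoefNonneg.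

Lemma tofrac_neq0 (R : realDomainType) (p : {mpoly R[7]}) :
  p.@[fun=> 1] != 0 -> tofrac p != 0.
Proof. by apply: contraNneq => /eqP; rewrite tofrac_eq0 => /eqP ->; rewrite meval0. Qed.

Lemma stieltjes_log_convex (R : realDomainType) (m : nat) (y : m.-tuple (ratfun R))
    (alpha : nat -> ratfun R) :
  tp (coef_ge0 y) (fun i j => alpha (i + j)%N) ->
  stieltjes_moment y alpha /\ log_convex 3 y alpha.
Proof.
move=> tp_alpha; split=> //.
exact: (log_convex3_tp (coef_ge0_semiring y) tp_alpha).
Qed.

(* In (vi) and (vii) the rows are not polynomials in x, since already
   T 1 0 = 2 * a2 * (b0 / a1), resp. T 1 1 = 2 * a2 * (b0 / a1); there
   nonnegativity is taken in x together with the quotient b0 / a1. *)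
Theorem theorem1p3 (R : realDomainType) (T : nat -> int -> ratfun R) :
  let a0 := indet R (inord 0) in
  let a1 := indet R (inord 1) in
  let a2 := indet R (inord 2) in
  let b0 := indet R (inord 3) in
  let b1 := indet R (inord 4) in
  let b2 := indet R (inord 5) in
  let q  := indet R (inord 6) in
  let x  := [tuple a0; a1; a2; b0; b1; b2; q] in
  let x' := [tuple a0; a1; a2; b0; b1; b2; q; b0 / a1] in
  triangular T ->
  ([\/ rec_i a0 a2 b0 b2 T, rec_ii a0 b0 b1 b2 T, rec_iii a1 a2 b1 b2 T |
       rec_iv a0 a2 b0 b2 T \/ rec_v_special a1 a2 b0 b2 T] ->
   stieltjes_moment x (row_poly q T) /\ log_convex 3 x (row_poly q T)) /\
  (rec_vi a1 a2 b0 T \/ rec_vii a1 a2 b0 T ->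
   stieltjes_moment x' (row_poly q T) /\ log_convex 3 x' (row_poly q T)).
Proof.
move=> a0 a1 a2 b0 b1 b2 q x x' Ttri.
split=> Trec; apply: stieltjes_log_convex.
  have Psr := coef_ge0_semiring x.
  have Pa0 : coef_ge0 x a0 by apply: (@coef_ge0_nth R _ x 0).
  have Pa1 : coef_ge0 x a1 by apply: (@coef_ge0_nth R _ x 1).
  have Pa2 : coef_ge0 x a2 by apply: (@coef_ge0_nth R _ x 2).
  have Pb0 : coef_ge0 x b0 by apply: (@coef_ge0_nth R _ x 3).
  have Pb1 : coef_ge0 x b1 by apply: (@coef_ge0_nth R _ x 4).
  have Pb2 : coef_ge0 x b2 by apply: (@coef_ge0_nth R _ x 5).
  have Pq : coef_ge0 x q by apply: (@coef_ge0_nth R _ x 6).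
  case: Trec => [||| []] Trec.
  - exact: (rec_i_tp Psr Pa0 Pa2 Pb0 Pb2 Pq Ttri Trec).
  - exact: (rec_ii_tp Psr Pa0 Pb0 Pb1 Pb2 Pq Ttri Trec).
  - exact: (rec_iii_tp Psr Pa1 Pa2 Pb1 Pb2 Pq Ttri Trec).
  - exact: (rec_iv_tp Psr Pa0 Pa2 Pb0 Pb2 Pq Ttri Trec).
  - case: Trec => a2' [b2' [a2'E b2'E special Trec]].
    have Pa2' : coef_ge0 x a2'.
      by move: a2'E; rewrite !inE => /or3P[] /eqP->; cone Psr.
    have Pb2' : coef_ge0 x b2'.
      by move: b2'E; rewrite !inE => /or3P[] /eqP->; cone Psr.
    exact: (rec_v_tp Psr Pa1 Pa2' Pb0 Pb2' Pq Ttri special Trec).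
have Psr := coef_ge0_semiring x'.
have Pa1 : coef_ge0 x' a1 by apply: (@coef_ge0_nth R _ x' 1).
have Pa2 : coef_ge0 x' a2 by apply: (@coef_ge0_nth R _ x' 2).
have Pq : coef_ge0 x' q by apply: (@coef_ge0_nth R _ x' 6).
have Pb : coef_ge0 x' (b0 / a1) by apply: (@coef_ge0_nth R _ x' 7).
have two_neq0 : 2 != 0 :> ratfun R.
  rewrite -(rmorph_nat (@tofrac ({mpoly R[7]} : idomainType))).
  by rewrite tofrac_neq0 // rmorph_nat pnatr_eq0.
have a1_neq0 : a1 != 0 by rewrite tofrac_neq0 // mevalXU oner_eq0.
case: Trec => Trec.
  apply: (rec_vi_tp Psr two_neq0 a1_neq0 Pa1 Pa2 Pq Pb Ttri _ Trec).
  apply: (add_double_quotient_neq0 a1_neq0).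
  (* With all indeterminates set to 1 the numerator takes the value 3. *)
  rewrite /q /a1 /b0 /indet -tofracM -tofracMn -tofracD; apply: tofrac_neq0.
  by rewrite mevalD mevalMn mevalM !mevalXU mulr1 -mulrS pnatr_eq0.
apply: (rec_vii_tp Psr two_neq0 a1_neq0 Pa1 Pa2 Pq Pb Ttri _ Trec).
rewrite [b0 / a1 * q]mulrAC; apply: (add_double_quotient_neq0 a1_neq0).
rewrite mul1r /q /a1 /b0 /indet -tofracM -tofracMn -tofracD; apply: tofrac_neq0.
by rewrite mevalD mevalMn mevalM !mevalXU mulr1 -mulrS pnatr_eq0.
Qed.
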